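(* Let $G=(V,E)$ be a connected, unweighted graph on $n$ vertices with maximum degree at most $\Delta$, accessible only through a distance oracle as described in the context. There is a randomized algorithm for the metric reconstruction problem on $G$ with query complexity $O(\Delta^4\cdot n^{3/2}\cdot\log^2 n\cdot \log\log n)$ (which is $\tilde{O}(n^{3/2})$ when $\Delta$ is constant).
   Context: Query model: the vertex set $V$ of a connected unweighted graph $G=(V,E)$ is given, and the shortest-path metric $\delta$ of $G$ is accessible only through an oracle $\textsc{Query}(u,v)$ which, on input $(u,v)\in V^2$, returns $\delta(u,v)$. The metric reconstruction problem is to determine $\delta$ on all of $V\times V$ (equivalently, to determine the edge set $E$). The query complexity of an algorithm is the number of oracle queries it makes. *)

(* Defs.v *)
From HB Require Import structures.
From mathcomp Require Import all_boot all_order all_algebra.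
From mathcomp Require Import reals exp.
Set Implicit Arguments.
Unset Strict Implicit.
Unset Printing Implicit Defensive.
Import Order.TTheory GRing.Theory Num.Theory.
Local Open Scope ring_scope.

Section Graphs.
Variable V : finType.
Implicit Types e : rel V.

Definition simple_graph e := symmetric e /\ irreflexive e.

Definition connected_graph e := forall u v : V, connect e u v.

Definition max_degree e : nat := (\max_(u : V) #|[pred v | e u v]|)%N.

Definition walk_of_length e (u v : V) (k : nat) : bool :=
  [exists p : k.-tuple V, path e u p && (last u p == v)].

(* The least k such that some walk of length k joins u to v.  Searching
   k < #|V| suffices, since a shortest walk repeats no vertex; the value is
   #|V| by convention when u and v are not connected. *)
Definition graph_dist e (u v : V) : nat :=
  find (walk_of_length e u v) (iota 0 #|V|).

Definition graph_metric e : {ffun V * V -> nat} :=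
  [ffun uv => graph_dist e uv.1 uv.2].

End Graphs.

(* Adaptive randomized oracle algorithms: [Query u v k] asks for the distance
   between u and v and continues with [k d], d being the answer; [Sample m k]
   draws i uniformly from 'I_m.+1, independently of all earlier draws, and
   continues with [k i].  The tree depends on the hidden graph only through
   the answers; draws and local computation are free. *)
Inductive query_alg (V T : Type) : Type :=
| Return of T
| Query of V & V & (nat -> query_alg V T)
| Sample (m : nat) of ('I_m.+1 -> query_alg V T).

Section Semantics.
Variables (R : realType) (V : finType) (T : eqType).
Implicit Types (a : query_alg V T) (delta : V -> V -> nat).

(* Expectation of [f output queries] over the draws, when [a] is run against
   the oracle [delta] after [q] queries have already been made. *)
Fixpoint expect delta (f : T -> nat -> R) (q : nat) a : R :=
  match a with
  | Return t => f t q
  | Query u v k => expect delta f q.+1 (k (delta u v))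
  | Sample m k => (\sum_(i < m.+1) expect delta f q (k i)) / m.+1%:R
  end.

Definition prob_output delta a (t : T) : R :=
  expect delta (fun t' _ => (t' == t)%:R) 0 a.

Definition expected_queries delta a : R :=
  expect delta (fun _ q => q%:R) 0 a.

End Semantics.

(* Main.v *)
(* For a set [A] of centers, the cluster of [w] consists of the vertices strictly
   closer to [w] than to [A].  If [b] lies two steps along a shortest path from
   the center nearest to [u] towards [u], both ends of an edge at [u] lie in the
   cluster of [b]; so it suffices to query all rows of the vertices within
   distance 2 of [A] and all pairs inside their clusters.

   It remains to find about sqrt n centers (up to logarithms) with all clusters
   of size O(sqrt n).  As in Thorup and Zwick, new centers are drawn from the set
   [W] of vertices whose cluster may still be large.  A vertex stays in [W] when
   a random test set [t] hits its cluster.  With k draws a vertex [v] lies on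
   average in at most |W|/(k+1) clusters of members of [W], which halves [W] in
   expectation, whereas a large cluster escapes [t] with probability at most
   n^-2.  Correctness never depends on the quality of [A]: a failure only costs
   additional queries, at most n^2 for each large cluster that remains. *)
Require Import Defs.
From Stdlib Require PeanoNat.
From HB Require Import structures.
From mathcomp Require Import all_boot all_order all_algebra.
From mathcomp Require Import reals sequences exp zify ring.
Set Implicit Arguments.
Unset Strict Implicit.
Unset Printing Implicit Defensive.
Import Order.TTheory GRing.Theory Num.Theory.
Local Open Scope ring_scope.

(** * Power inequalities over the natural numbers *)

Lemma bernoulli_leq (x c k : nat) :
  (x ^ k.+1 + k.+1 * (x ^ k * c) <= (x + c) ^ k.+1)%N.
Proof.
elim: k => [|k IHk]; first by rewrite !expn1 expn0 !mul1n.
rewrite [leqRHS]expnS; apply: leq_trans (leq_mul (leqnn _) IHk).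
have -> : (x ^ k.+2 + k.+2 * (x ^ k.+1 * c) =
           x * (x ^ k.+1 + k.+1 * (x ^ k * c)) + c * x ^ k.+1)%N.
  by rewrite !expnS; lia.
by rewrite mulnDl leq_add2l leq_mul2l leq_addr orbT.
Qed.

(** A union bound in counting form: [k.+1] coordinates, each with [c] bad values out of [n]. *)
Lemma expn_subl_leq (n c k : nat) : (c <= n)%N ->
  (n ^ k.+1 <= (n - c) ^ k.+1 + k.+1 * (c * n ^ k))%N.
Proof.
move=> cn; elim: k => [|k IHk]; first by rewrite !expn1 expn0 muln1 mul1n subnK.
rewrite expnS; apply: leq_trans (leq_mul (leqnn n) IHk) _.
rewrite mulnDr -{1}(subnK cn) mulnDl -expnS -addnA leq_add2l.
rewrite [leqRHS]mulSn leq_add //.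
  by rewrite leq_mul2l leq_exp2r // leq_subr orbT.
by rewrite mulnCA leq_mul2l mulnCA -expnS leqnn orbT.
Qed.

(** Bernoulli at [x = n - c] gives [2 (n - c)^r <= n^r], since [r c >= n >= n - c]; then take [l]-th
    powers. *)
Lemma halving_leq (n c r l : nat) : (0 < r)%N -> (c <= n)%N ->
  (n <= r * c)%N -> ((n - c) ^ (r * l) * 2 ^ l <= n ^ (r * l))%N.
Proof.
case: r => [//|r] _ cn nrc.
rewrite !expnM -expnMn.
case: l => [|l]; first by [].
rewrite leq_exp2r // muln2 -addnn.
rewrite -[X in (_ <= X ^ _)%N](subnK cn).
apply: leq_trans (bernoulli_leq _ _ _); rewrite leq_add2l mulnCA expnS mulnC.
by rewrite leq_mul2l (leq_trans (leq_subr _ _) nrc) orbT.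
Qed.

(** * Counting tuples of independent draws *)

Section Draws.
Variable V : finType.
Implicit Types W C : {set V}.

Definition draws k W : {set {ffun 'I_k -> V}} :=
  [set f | f \in ffun_on [in W]].

Lemma card_draws k W : #|draws k W| = (#|W| ^ k)%N.
Proof. by rewrite cardsE card_ffun_on card_ord. Qed.

Lemma drawsP k W (f : {ffun 'I_k -> V}) :
  reflect (forall j, f j \in W) (f \in draws k W).
Proof. by rewrite inE; apply: (iffP ffun_onP). Qed.

(* Induction on [W], removing a minimiser of [g], which is above nobody. *)
Lemma sum_above_leq (g : V -> nat) W k :
  (k.+1 * \sum_(w in W) #|[set a in W | g w < g a]| ^ k <= #|W| ^ k.+1)%N.
Proof.
move En : #|W| => n; elim: n W En => [|n IHn] W cW.
  by rewrite big_pred0 ?muln0 // => w; rewrite (cards0_eq cW) inE.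
have /card_gt0P[w0 w0W] : (0 < #|W|)%N by rewrite cW.
pose w := [arg min_(x < w0 in W) g x].
have [wW wmin] : w \in W /\ forall x, x \in W -> (g w <= g x)%N.
  by rewrite /w; case: arg_minnP.
have cWw : #|W :\ w| = n by apply/eqP; move: (cardsD1 w W); rewrite wW cW => -[->].
rewrite (big_setD1 w) //= mulnDr.
(* The term of [w] is at most [n ^ k], the others sum to the induction hypothesis, and Bernoulli
   with [c = 1] combines them. *)
rewrite -(addn1 n); apply: leq_trans (bernoulli_leq _ _ _); rewrite addnC muln1.
apply: leq_add; last first.
  rewrite leq_mul2l; apply/orP; right; case: (posnP k) => [->//|k0].
  rewrite leq_exp2r // -cWw; apply/subset_leq_card/subsetP => a.
  by rewrite !inE => /andP[-> ]; rewrite andbT; apply: contraTneq => ->; rewrite ltnn.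
apply: leq_trans (IHn _ cWw); rewrite leq_mul2l; apply/orP; right.
apply: leq_sum => x xW; case: (posnP k) => [->//|k0].
rewrite leq_exp2r //; apply/subset_leq_card/subsetP => a.
rewrite !inE => /andP[aW xa]; rewrite aW xa !andbT.
move: xW; rewrite !inE => /andP[_ xW].
by apply: contraTneq xa => ->; rewrite -leqNgt wmin.
Qed.
End Draws.

(** * Averages over finite sets *)

Section Average.
Variables (R : realType) (X : finType).
Implicit Types (S : {set X}) (F G : X -> R).

Definition avg S F : R := (\sum_(x in S) F x) / #|S|%:R.

Lemma avg_le S F G : (forall x, x \in S -> F x <= G x) -> avg S F <= avg S G.
Proof. by move=> FG; rewrite ler_wpM2r ?invr_ge0 // ler_sum. Qed.

Lemma avg_cst S (c : R) : S != set0 -> avg S (fun=> c) = c.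
Proof.
rewrite -card_gt0 => S0; rewrite /avg sumr_const -[c *+ _]mulr_natr mulfK //.
by rewrite pnatr_eq0 -lt0n.
Qed.

Lemma avgD S F G : avg S (fun x => F x + G x) = avg S F + avg S G.
Proof. by rewrite /avg big_split mulrDl. Qed.

Lemma avgZ S (c : R) F : avg S (fun x => c * F x) = c * avg S F.
Proof. by rewrite /avg -mulr_sumr mulrA. Qed.

Lemma avg_sum S (I : finType) (P : pred I) (F : I -> X -> R) :
  avg S (fun x => \sum_(i | P i) F i x) = \sum_(i | P i) avg S (F i).
Proof. by rewrite /avg exchange_big mulr_suml. Qed.

Lemma avg_indicator S (P : pred X) :
  avg S (fun x => (P x)%:R) = #|[set x in S | P x]|%:R / #|S|%:R.
Proof.
rewrite /avg; congr (_ / _); rewrite -natr_sum; congr (_%:R).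
by rewrite -sum1dep_card big_mkcondr; apply: eq_bigr => x _; case: (P x).
Qed.

End Average.

(** * Hitting and missing probabilities of random draws *)

Section Sampling.
Variables (R : realType) (V : finType).
Implicit Types W C : {set V}.

Lemma draws_neq0 k W : W != set0 -> draws k W != set0.
Proof. by rewrite -!card_gt0 card_draws expn_gt0 => ->. Qed.

(** A union bound over the draws: the tuples that hit [C] are counted as the complement of those
    that avoid it. *)
Lemma avg_hit_le m C : (0 < #|V|)%N ->
  avg (draws m [set: V]) (fun t => [exists j, t j \in C]%:R)
    <= m%:R * #|C|%:R / #|V|%:R :> R.
Proof.
move=> V0; rewrite avg_indicator card_draws cardsT.
have V0R : (0 : R) < #|V|%:R by rewrite ltr0n.
case: m => [|m].
  rewrite (_ : [set _ in _ | _] = set0) ?cards0 ?mul0r //.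
  by apply/setP => t; rewrite !inE; apply/negP => /andP[_ /existsP[[]]].
rewrite ler_pdivrMr ?ltr0n ?expn_gt0 ?V0 // mulrAC ler_pdivlMr //.
rewrite -!natrM ler_nat expnS [leqRHS]mulnCA mulnC leq_mul2l; apply/orP; right.
have le_CV : (#|C| <= #|V|)%N by exact: max_card.
rewrite -mulnA -(leq_add2l ((#|V| - #|C|) ^ m.+1)).
apply: leq_trans (expn_subl_leq m le_CV).
have <- : #|draws m.+1 (~: C)| = ((#|V| - #|C|) ^ m.+1)%N.
  by rewrite card_draws cardsCs setCK.
have <- : #|draws m.+1 [set: V]| = (#|V| ^ m.+1)%N by rewrite card_draws cardsT.
rewrite -[leqRHS](cardsID (draws m.+1 (~: C))).
have /setIidPr -> : draws m.+1 (~: C) \subset draws m.+1 [set: V].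
  by apply/subsetP => t _; apply/drawsP => j; rewrite inE.
rewrite leq_add2l; apply: subset_leq_card; apply/subsetP => t.
case/setIdP => tT /existsP[j tj]; rewrite in_setD tT andbT.
by apply: contraL tj => /drawsP/(_ j); rewrite inE.
Qed.

(** A block of [r] draws misses a set of density at least [1/r] with probability at most one half,
    and there are [l] independent blocks. *)
Lemma avg_miss_le r l C : (0 < #|V|)%N -> (0 < r)%N -> (#|V| <= r * #|C|)%N ->
  avg (draws (r * l) [set: V]) (fun t => (~~ [exists j, t j \in C])%:R)
    <= (2 ^+ l)^-1 :> R.
Proof.
move=> V0 r0 VC; rewrite avg_indicator card_draws cardsT.
have -> : [set t in draws (r * l) [set: V] | ~~ [exists j, t j \in C]] =
          draws (r * l) (~: C).
  apply/setP => t; rewrite inE; apply/andP/drawsP => [[_ /existsPn h] j|h].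
    by rewrite inE.
  by split; [apply/drawsP => j; rewrite inE|apply/existsPn => j; have := h j; rewrite inE].
rewrite card_draws cardsCs setCK ler_pdivrMr ?ltr0n ?expn_gt0 ?V0 //.
rewrite mulrC ler_pdivlMr ?exprn_gt0 // -natrX -natrM ler_nat.
by apply: halving_leq => //; exact: max_card.
Qed.

(** Among [k.+1] independent uniform elements of [W], a given one is the strict minimum of [g] with
    probability at most [1/(k+1)], by symmetry. *)
Lemma avg_below_le (g : V -> nat) k W :
  avg (draws k W) (fun a => #|[set w in W | [forall j, (g w < g (a j))%N]]|%:R)
    <= #|W|%:R / k.+1%:R :> R.
Proof.
have [->|W0] := eqVneq W set0.
  rewrite cards0 mul0r /avg big1 ?mul0r // => a _.
  by rewrite [X in #|pred_of_set X|](_ : _ = set0) ?cards0 //; apply/setP => w; rewrite !inE.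
have cW : (0 < #|W|)%N by rewrite card_gt0.
rewrite /avg card_draws ler_pdivrMr ?ltr0n ?expn_gt0 ?cW // mulrAC.
rewrite ler_pdivlMr ?ltr0n // -natrM -natr_sum -natrM ler_nat -expnS.
apply: leq_trans (sum_above_leq g W k); rewrite mulnC leq_mul2l; apply/orP; right.
under eq_bigr => a _ do rewrite -sum1dep_card big_mkcondr.
rewrite exchange_big /=; apply: leq_sum => w wW.
rewrite -card_draws -big_mkcondr sum1dep_card; apply: subset_leq_card.
apply/subsetP => a; rewrite inE => /andP[/drawsP aW /forallP ga].
by apply/drawsP => j; rewrite inE aW ga.
Qed.

End Sampling.

(** * Clusters and the expected effect of one round *)

Section Refinement.
Variables (R : realType) (V : finType).
Implicit Types (d : V -> V -> nat) (A W : {set V}).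

Definition cluster d A w : {set V} := [set v | [forall a in A, (d w v < d a v)%N]].

Definition survivors d A W m (t : {ffun 'I_m -> V}) : {set V} :=
  [set w in W | [exists j, t j \in cluster d A w]].

Definition large d M A : {set V} := [set w | (M < #|cluster d A w|)%N].

Definition add_draw A k (a : {ffun 'I_k -> V}) : {set V} := A :|: [set a j | j in 'I_k].

Lemma cluster_anti d A A' w : A \subset A' -> cluster d A' w \subset cluster d A w.
Proof.
move=> sAA'; apply/subsetP => v; rewrite !inE => /forall_inP h.
by apply/forall_inP => a /(subsetP sAA') /h.
Qed.

Lemma large_anti d M A A' : A \subset A' -> large d M A' \subset large d M A.
Proof.
move=> sAA'; apply/subsetP => w; rewrite !inE => /leq_trans; apply.
exact/subset_leq_card/cluster_anti.
Qed.

(** If [v] stays in the cluster of [w], then [w] is strictly closer to [v] than every draw. Apply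
    [avg_below_le] to [g w = d w v] for each [v] and exchange the sums. *)
Lemma avg_sum_cluster_le d A W k :
  avg (draws k W) (fun a => (\sum_(w in W) #|cluster d (add_draw A a) w|)%:R)
    <= #|V|%:R * #|W|%:R / k.+1%:R :> R.
Proof.
rewrite -mulrA mulr_natl -sumr_const.
apply: le_trans (ler_sum _ (fun v _ => avg_below_le R (fun w => d w v) k W)).
rewrite -avg_sum; apply: avg_le => a _; rewrite -natr_sum ler_nat.
under eq_bigr => w _ do rewrite -sum1_card big_mkcond.
rewrite exchange_big /=; apply: leq_sum => v _.
rewrite -sum1dep_card [leqRHS]big_mkcondr; apply: leq_sum => w _.
rewrite inE; case: ifP => // /forall_inP h; case: ifPn => // /forallPn[j].
by rewrite h // inE imset_f ?orbT.
Qed.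

(** With [m = r l] test points a cluster is hit with probability at most [m] times its density;
    averaging over the new centers gives [m |W| / (k+1)]. *)
Lemma avg_survivors_le d r l A W k :
  (0 < #|V|)%N -> (2 * (r * l) <= k.+1)%N ->
  avg (draws k W) (fun a => avg (draws (r * l) [set: V])
     (fun t => #|survivors d (add_draw A a) W t|%:R)) <= #|W|%:R / 2 :> R.
Proof.
move=> V0 mk; set m := (r * l)%N.
have V0R : (0 : R) < #|V|%:R by rewrite ltr0n.
apply: (@le_trans _ _ (m%:R / #|V|%:R * (#|V|%:R * #|W|%:R / k.+1%:R))); last first.
  rewrite mulrA mulrA -[_ / _ * _]mulrA mulVf ?gt_eqF // mulr1 ler_pdivrMr ?ltr0n //.
  rewrite mulrAC ler_pdivlMr // -!natrM ler_nat mulnAC mulnC leq_mul2l.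
  by rewrite [(m * 2)%N]mulnC mk orbT.
apply: le_trans (ler_wpM2l _ (avg_sum_cluster_le d A W k)); last first.
  by rewrite divr_ge0.
rewrite -avgZ; apply: avg_le => a _.
rewrite natr_sum mulr_sumr.
apply: (@le_trans _ _ (\sum_(w in W) avg (draws m [set: V])
   (fun t => [exists j, t j \in cluster d (add_draw A a) w]%:R))); last first.
  by apply: ler_sum => w _; apply: le_trans (avg_hit_le R m _ V0) _; rewrite mulrAC.
rewrite -avg_sum; apply: avg_le => t _.
rewrite -natr_sum ler_nat -sum1dep_card big_mkcondr.
by apply: leq_sum => w _; case: [exists _, _].
Qed.

(** A large cluster whose center does not survive either was already large with its center outside
    [W], or is missed by the test set. The latter has probability at most [2^-l], because
    [#|V| <= r * r] gives large clusters density at least [1/r]. *)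
Lemma avg_missed_le d r l A W k :
  (0 < #|V|)%N -> (0 < r)%N -> (#|V| <= r * r)%N -> W != set0 ->
  avg (draws k W) (fun a => avg (draws (r * l) [set: V])
     (fun t => #|large d r (add_draw A a) :\: survivors d (add_draw A a) W t|%:R))
  <= #|large d r A :\: W|%:R + #|V|%:R / 2 ^+ l :> R.
Proof.
move=> V0 r0 Vr W0.
rewrite -[leRHS](avg_cst _ (draws_neq0 k W0)); apply: avg_le => a _.
set A' := add_draw A a.
have sAA' : A \subset A' by exact: subsetUl.
have T0 : draws (r * l) [set: V] != set0.
  by apply: draws_neq0; rewrite -card_gt0 cardsT.
apply: (@le_trans _ _ (avg (draws (r * l) [set: V]) (fun t =>
   #|large d r A :\: W|%:R +
   \sum_(w in large d r A') (~~ [exists j, t j \in cluster d A' w])%:R))).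
  apply: avg_le => t _; rewrite -natr_sum -natrD ler_nat.
  apply: (@leq_trans #|(large d r A :\: W) :|:
     [set w in large d r A' | ~~ [exists j, t j \in cluster d A' w]]|).
    apply/subset_leq_card/subsetP => w; rewrite in_setD => /andP[wS wL].
    move: wS; rewrite in_setU in_setD (subsetP (large_anti _ _ sAA') _ wL) andbT.
    by rewrite inE wL [w \in survivors _ _ _ _]inE negb_and.
  rewrite cardsU; apply: leq_trans (leq_subr _ _) _; rewrite leq_add2l.
  by rewrite -sum1dep_card big_mkcondr; apply: leq_sum => w _; case: [exists _, _].
rewrite avgD avg_cst // lerD2l avg_sum mulr_natl -[X in _ <= _ *+ X]cardsT -sumr_const.
rewrite [leRHS](bigID (mem (large d r A'))) /= -[leLHS]addr0; apply: lerD.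
  under [leRHS]eq_bigl => w do rewrite in_setT.
  apply: ler_sum => w; rewrite inE => /ltnW h.
  apply: avg_miss_le => //; apply: leq_trans Vr _.
  by rewrite leq_mul2l h orbT.
by apply: sumr_ge0 => w _; rewrite invr_ge0 exprn_ge0.
Qed.

End Refinement.

(** * Correctness and query cost of oracle programs *)

Section OracleCalculus.
Variables (V : finType) (T : eqType).
Implicit Types (d : V -> V -> nat) (K : {ffun V * V -> nat}) (t : T).

Definition record K (p : V * V) (x : nat) : {ffun V * V -> nat} :=
  [ffun q => if q == p then x else K q].

(* Oracle answers are accumulated in a table; pairs never queried keep the value
   they have in the initial table. *)
Fixpoint ask (s : seq (V * V)) K (k : {ffun V * V -> nat} -> query_alg V T) :=
  if s is p :: s' then Query p.1 p.2 (fun x => ask s' (record K p x) k) else k K.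

(** The table that [ask s K] hands to its continuation when run against [d]. *)
Definition known d (s : seq (V * V)) K : {ffun V * V -> nat} :=
  [ffun p => if p \in s then d p.1 p.2 else K p].

(* [k0] is the continuation when [S] is empty. *)
Definition pick_unif (X : finType) (S : {set X}) (k : X -> query_alg V T)
    (k0 : query_alg V T) :=
  if enum S is x0 :: s then Sample (fun i : 'I_(size s).+1 => k (nth x0 (x0 :: s) i))
  else k0.

(* The result is [t] whatever the draws. *)
Fixpoint returns d (a : query_alg V T) t : Prop :=
  match a with
  | Return t' => t' = t
  | Query u v k => returns d (k (d u v)) t
  | Sample m k => forall i, returns d (k i) t
  end.

Lemma known_record d p s K : known d s (record K p (d p.1 p.2)) = known d (p :: s) K.
Proof.
apply/ffunP => q; rewrite !ffunE inE.
by case: (q =P p) => [->|_]; case: ifP.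
Qed.

Lemma known_nil d K : known d [::] K = K.
Proof. by apply/ffunP => q; rewrite !ffunE. Qed.

Lemma returns_ask d s K k t : returns d (k (known d s K)) t -> returns d (ask s K k) t.
Proof.
elim: s K => [|p s IHs] K /=; first by rewrite known_nil.
by rewrite -known_record => /IHs.
Qed.

Lemma returns_pick_unif d (X : finType) (S : {set X}) k k0 t :
  (forall x, returns d (k x) t) -> returns d k0 t -> returns d (pick_unif S k k0) t.
Proof. by rewrite /pick_unif; case: (enum S) => /=. Qed.

Variable R : realType.

Lemma returns_prob d a t : returns d a t -> prob_output R d a t = 1.
Proof.
rewrite /prob_output; move: 0%N; elim: a => [t'|u v k IHk|m k IHk] q /=.
- by move=> ->; rewrite eqxx.
- exact: IHk.
- move=> rk; under eq_bigr => i _ do rewrite IHk //.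
  by rewrite sumr_const card_ord divff // pnatr_eq0.
Qed.

Lemma expect_queries d q a :
  expect d (fun (_ : T) q => q%:R : R) q a = q%:R + expected_queries R d a.
Proof.
rewrite /expected_queries; elim: a q => [t|u v k IHk|m k IHk] q /=.
- by rewrite addr0.
- by rewrite IHk [in RHS]IHk addrA -[in LHS]addn1 natrD.
- under eq_bigr => i _ do rewrite IHk.
  rewrite big_split mulrDl sumr_const card_ord -[_ *+ m.+1]mulr_natr mulfK //.
  by rewrite pnatr_eq0.
Qed.

Lemma expected_queries_ask d s K k :
  expected_queries R d (ask s K k) = (size s)%:R + expected_queries R d (k (known d s K)).
Proof.
elim: s K => [|p s IHs] K /=; first by rewrite known_nil add0r.
rewrite [LHS]/expected_queries /= expect_queries IHs known_record addrA.
by rewrite -natrD add1n.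
Qed.

Lemma expected_queries_pick d (X : finType) (S : {set X}) k k0 : S != set0 ->
  expected_queries R d (pick_unif S k k0) = avg S (fun x => expected_queries R d (k x)).
Proof.
rewrite -card_gt0 /pick_unif /avg cardE -big_enum /=; case: (enum S) => //= x0 s _.
by rewrite (big_nth x0) big_mkord.
Qed.

Lemma expected_queries_pick0 d (X : finType) (S : {set X}) k k0 : S = set0 ->
  expected_queries R d (pick_unif S k k0) = expected_queries R d k0.
Proof. by move=> ->; rewrite /pick_unif enum_set0. Qed.

End OracleCalculus.

(** * The algorithm and its expected cost *)

Section Algorithm.
Variable V : finType.
Implicit Types (d : V -> V -> nat) (A W : {set V}) (K : {ffun V * V -> nat}).

Definition lookup K u v := K (u, v).

Definition nothing : {ffun V * V -> nat} := [ffun=> 0%N].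

(** A fresh table serves each round, since the test compares only distances to the points of [t],
    all of which are queried. With nothing to draw, refinement stops early at [cont A]. *)
Fixpoint refine_centers (T : eqType) k m L A W (cont : {set V} -> query_alg V T) :=
  if L is L'.+1 then
    pick_unif (draws k W) (fun a => pick_unif (draws m [set: V]) (fun t =>
      ask [seq (v, x) | v <- enum V, x <- codom t] nothing (fun K =>
        refine_centers k m L' (add_draw A a)
          (survivors (lookup K) (add_draw A a) W t) cont))
      (cont A)) (cont A)
  else cont A.

Definition near d A : {set V} := [set b | [exists a in A, (d a b <= 2)%N]].

Definition candidates d A : {set V * V} :=
  [set p | [exists b in near d A, (p.1 \in cluster d A b) && (p.2 \in cluster d A b)]].

(** Both orders are inspected because querying a row records only one of them. *)
Definition found_edge K : rel V := [rel u v | (K (u, v) == 1%N) || (K (v, u) == 1%N)].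

(** The phases are adaptive: the rows of [A] determine [near], and together with the rows of [near]
    they determine the clusters. *)
Definition reconstruct A : query_alg V {ffun V * V -> nat} :=
  ask [seq (a, v) | a <- enum A, v <- enum V] nothing (fun K1 =>
  ask [seq (b, v) | b <- enum (near (lookup K1) A), v <- enum V] K1 (fun K2 =>
  ask (enum (candidates (lookup K2) A)) K2 (fun K3 =>
  Return V (graph_metric (found_edge K3))))).

Definition known_rows d (S : {set V}) K :=
  known d [seq (b, v) | b <- enum S, v <- enum V] K.

Lemma known_rowsE d S K u v :
  known_rows d S K (u, v) = if u \in S then d u v else K (u, v).
Proof.
rewrite ffunE (_ : ((u, v) \in _) = (u \in S)) //.
apply/allpairsP/idP => [[[x y] /= [xS _ [-> _]]]|uS]; first by rewrite -mem_enum.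
by exists (u, v); rewrite /= !mem_enum.
Qed.

Lemma near_known d A K : near (lookup (known_rows d A K)) A = near d A.
Proof.
apply/setP => b; rewrite !inE; apply: eq_existsb => a; case aA: (a \in A) => //=.
by rewrite /lookup known_rowsE aA.
Qed.

Lemma candidates_known d A S K : S = near d A ->
  candidates (lookup (known_rows d S (known_rows d A K))) A = candidates d A.
Proof.
move=> ->; set K2 := known_rows _ _ _.
have rowA a v : a \in A -> lookup K2 a v = d a v.
  by move=> aA; rewrite /lookup /K2 !known_rowsE aA; case: ifP.
have nearE : near (lookup K2) A = near d A.
  apply/setP => b; rewrite !inE; apply: eq_existsb => a.
  by case aA: (a \in A) => //=; rewrite rowA.
apply/setP => p; rewrite !inE nearE; apply: eq_existsb => b.
case bS: (b \in near d A) => //=.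
suff -> : cluster (lookup K2) A b = cluster d A b by [].
apply/setP => v; rewrite !inE; apply: eq_forallb => a; case aA: (a \in A) => //=.
by rewrite (rowA a) // /lookup /K2 known_rowsE bS.
Qed.

Lemma survivors_known d s A W m (t : {ffun 'I_m -> V}) K :
  (forall v j, (v, t j) \in s) ->
  survivors (lookup (known d s K)) A W t = survivors d A W t.
Proof.
move=> st; apply/setP => w; rewrite !inE; congr (_ && _).
apply: eq_existsb => j; rewrite !inE; apply: eq_forallb => a.
by rewrite /lookup !ffunE !st.
Qed.

Lemma mem_columns m (t : {ffun 'I_m -> V}) v j :
  (v, t j) \in [seq (v, x) | v <- enum V, x <- codom t].
Proof. by apply/allpairsP; exists (v, t j); rewrite /= mem_enum codom_f. Qed.

Lemma returns_refine (T : eqType) d k m L A W cont (y : T) :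
  (forall A', A \subset A' -> returns d (cont A') y) ->
  returns d (refine_centers k m L A W cont) y.
Proof.
elim: L A W => [|L IHL] A W rc /=; first exact: rc.
apply: returns_pick_unif => [a|]; last exact: rc.
apply: returns_pick_unif => [t|]; last exact: rc.
apply: returns_ask; apply: IHL => A' sA; apply: rc.
exact: subset_trans (subsetUl _ _) sA.
Qed.

Variable R : realType.

(* The potential is |W| / 2^L plus the number of large clusters outside [W]: a
   round preserves it in expectation, up to the n / 2^l clusters that the test
   set misses. *)
Lemma expected_queries_refine (T : eqType) d r l k L A W
    (cont : {set V} -> query_alg V T) (Z c : R) :
  (0 < #|V|)%N -> (0 < r)%N -> (#|V| <= r * r)%N -> (0 < k)%N ->
  (2 * (r * l) <= k.+1)%N -> 0 <= c ->
  (forall A', (#|A'| <= #|A| + L * k)%N ->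
     expected_queries R d (cont A') <= Z + c * #|large d r A'|%:R) ->
  expected_queries R d (refine_centers k (r * l) L A W cont) <=
    (L * (#|V| * (r * l)))%:R + Z +
    c * (#|W|%:R / 2 ^+ L + #|large d r A :\: W|%:R + L%:R * (#|V|%:R / 2 ^+ l)).
Proof.
move=> V0 r0 Vr k0 rlk c0; set m := (r * l)%N.
have T0 : draws m [set: V] != set0.
  by apply: draws_neq0; rewrite -card_gt0 cardsT.
elim: L A W => [|L IHL] A W hc /=.
  rewrite mul0n add0r mul0r addr0 expr0 divr1; apply: le_trans (hc _ _) _.
    by rewrite mul0n addn0.
  rewrite lerD2l ler_wpM2l // -natrD ler_nat -(cardsID W (large d r A)).
  by rewrite leq_add2r subset_leq_card ?subsetIr.
(* With [W] empty and [k > 0] there are no draws, so the run jumps to [cont A]. *)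
have [->|W0] := eqVneq W set0.
  rewrite expected_queries_pick0; last first.
    by apply/eqP; rewrite -cards_eq0 card_draws cards0 exp0n.
  apply: le_trans (hc A (leq_addr _ _)) _.
  rewrite setD0 cards0 mul0r add0r lerD //; first by rewrite lerDr ler0n.
  by rewrite ler_wpM2l // lerDl mulr_ge0 // divr_ge0 // exprn_ge0.
rewrite expected_queries_pick ?draws_neq0 //.
set tail := L%:R * _ in IHL.
pose surv (a : {ffun 'I_k -> V}) (t : {ffun 'I_m -> V}) :=
  survivors d (add_draw A a) W t.
pose miss a t := large d r (add_draw A a) :\: surv a t.
have step a : a \in draws k W ->
  expected_queries R d (pick_unif (draws m [set: V]) (fun t =>
     ask [seq (v, x) | v <- enum V, x <- codom t] nothing (fun K =>
        refine_centers k m L (add_draw A a)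
          (survivors (lookup K) (add_draw A a) W t) cont)) (cont A)) <=
  (L.+1 * (#|V| * m))%:R + Z + c * tail +
    c * ((2 ^+ L)^-1 * avg (draws m [set: V]) (fun t => #|surv a t|%:R) +
         avg (draws m [set: V]) (fun t => #|miss a t|%:R)).
  move=> _; rewrite expected_queries_pick // -avgZ -avgD -avgZ.
  rewrite -[X in X + avg _ _](avg_cst _ T0) -avgD; apply: avg_le => t _.
  rewrite expected_queries_ask survivors_known; last exact: mem_columns.
  rewrite size_allpairs -cardE size_codom card_ord.
  apply: le_trans (lerD (lexx _) (IHL _ _ _)) _.
    move=> A' sA'; apply: hc; apply: leq_trans sA' _.
    rewrite mulSn addnA leq_add2r (leq_trans (leq_card_setU _ _)) // leq_add2l.
    by rewrite (leq_trans (leq_imset_card _ _)) ?card_ord.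
  rewrite [(L.+1 * _)%N]mulSn natrD /miss /surv.
  suff arrange x y p q u : x + (y + Z + c * (p / q + u + tail)) =
      x + y + Z + c * tail + c * (q^-1 * p + u) :> R by rewrite arrange.
  by ring.
apply: le_trans (avg_le step) _.
rewrite avgD avg_cst ?draws_neq0 // avgZ avgD avgZ -addrA lerD2l -mulrDr.
rewrite ler_wpM2l // addrC.
apply: le_trans (lerD (lerD (ler_wpM2l _ (avg_survivors_le R d A W V0 rlk))
  (avg_missed_le R d l A k V0 r0 Vr W0)) (lexx _)) _.
  by rewrite invr_ge0 exprn_ge0.
rewrite le_eqVlt; apply/orP; left; apply/eqP.
rewrite /tail exprS invfM -natr1; ring.
Qed.


Lemma card_cover_leq (I : finType) (P : {set I}) (F : I -> {set V}) c :
  (forall i, i \in P -> (#|F i| <= c)%N) -> (#|\bigcup_(i in P) F i| <= #|P| * c)%N.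
Proof.
move=> Fc; rewrite -sum_nat_const.
elim/big_rec2: _ => [|i n U iP IH]; first by rewrite cards0.
by rewrite (leq_trans (leq_card_setU _ _)) // leq_add // Fc.
Qed.

(** Sum the squared cluster sizes over [near d A], charging [M ^ 2] always and a further [#|V| ^ 2]
    for a large cluster. *)
Lemma card_candidates_leq d M A :
  (#|candidates d A| <= #|near d A| * M ^ 2 + #|V| ^ 2 * #|large d M A|)%N.
Proof.
apply: (@leq_trans (\sum_(b in near d A) #|cluster d A b| ^ 2)).
  apply: (@leq_trans #|\bigcup_(b in near d A) setX (cluster d A b) (cluster d A b)|).
    apply/subset_leq_card/subsetP => p; rewrite inE => /exists_inP[b bS h].
    by apply/bigcupP; exists b; rewrite // inE.
  elim/big_rec2: _ => [|b n U bS IH]; first by rewrite cards0.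
  by rewrite (leq_trans (leq_card_setU _ _)) // leq_add // cardsX.
apply: (@leq_trans (\sum_(b in near d A) (M ^ 2 + (b \in large d M A) * #|V| ^ 2))).
  apply: leq_sum => b _; rewrite inE; case: leqP => [h|_].
    by rewrite mul0n addn0 leq_exp2r.
  by rewrite mul1n (leq_trans _ (leq_addl _ _)) // leq_exp2r // max_card.
rewrite big_split sum_nat_const leq_add2l -big_distrl [leqRHS]mulnC leq_mul2r /=.
apply/orP; right; rewrite -big_mkcondr sum1dep_card subset_leq_card //.
by apply/subsetP => b; rewrite inE => /andP[].
Qed.

Lemma expected_queries_reconstruct d M A c :
  (#|near d A| <= c)%N ->
  expected_queries R d (reconstruct A) <=
    (#|A| * #|V| + c * #|V| + c * M ^ 2)%:R + #|V|%:R ^+ 2 * #|large d M A|%:R.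
Proof.
move=> Sc; rewrite /reconstruct expected_queries_ask near_known.
rewrite expected_queries_ask -!/(known_rows _ _ _) candidates_known //.
rewrite expected_queries_ask [X in _ + (_ + (_ + X))]/expected_queries /= addr0.
rewrite -natrX -!natrM -!natrD ler_nat !size_allpairs -!cardE -!addnA leq_add2l.
apply: leq_add; first by rewrite leq_mul2r Sc orbT.
apply: leq_trans (card_candidates_leq d M A) _.
by rewrite leq_add2r leq_mul2r Sc orbT.
Qed.

End Algorithm.

(** * Shortest paths and coverage of edges *)

Section ShortestPaths.
Variables (V : finType) (e : rel V).
Local Notation d := (graph_dist e).

Lemma graph_dist_le u p : path e u p -> (d u (last u p) <= size p)%N.
Proof.
move=> up; rewrite leqNgt; apply/negP => lt_p.
(* [find] never exceeds [#|V|], so [size p] lies in the searched range. *)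
have p_lt : (size p < #|V|)%N.
  by rewrite (leq_trans lt_p) // -[leqRHS](size_iota 0) find_size.
have := before_find 0%N lt_p; rewrite nth_iota // add0n => /negbT/existsPn.
by move=> /(_ (in_tuple p)); rewrite up eqxx.
Qed.

Hypothesis e_conn : connected_graph e.

(** A path without repeated vertices has fewer than [#|V|] edges, so the search succeeds and its
    default value does not occur. *)
Lemma graph_dist_path u v :
  exists p, [/\ path e u p, last u p = v & size p = d u v].
Proof.
have hasw : has (walk_of_length e u v) (iota 0 #|V|).
  have /connectP[p0 up0 ->] := e_conn u v; case/shortenP: up0 => p up Up _.
  apply/hasP; exists (size p).
    by rewrite mem_iota; have := max_card [in u :: p]; rewrite (card_uniqP Up).
  by apply/existsP; exists (in_tuple p); rewrite up eqxx.
have := nth_find 0%N hasw; move: hasw; rewrite has_find size_iota => lt_d.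
rewrite nth_iota // add0n => /existsP[p /andP[up /eqP lp]].
by exists p; rewrite size_tuple.
Qed.

Lemma graph_dist_edge_le u v w : e v w -> (d u w <= (d u v).+1)%N.
Proof.
move=> vw; have [p [up lp sp]] := graph_dist_path u v.
have := @graph_dist_le u (rcons p w); rewrite rcons_path up lp vw last_rcons.
by rewrite size_rcons sp; apply.
Qed.

Hypothesis e_simple : simple_graph e.

Lemma graph_dist_eq1 u v : (d u v == 1%N) = e u v.
Proof.
have [_ e_irr] := e_simple; apply/eqP/idP => [d1|uv].
  have [p []] := graph_dist_path u v; rewrite d1.
  by case: p => [|x []] //= /andP[ux _] <-.
have := @graph_dist_le u [:: v]; rewrite /= uv => /(_ isT).
rewrite leq_eqVlt => /predU1P[//|]; rewrite ltnS leqn0 => /eqP d0.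
have [p [_]] := graph_dist_path u v; rewrite d0 => lp /eqP; rewrite size_eq0.
by move=> /eqP p0; move: uv; rewrite -lp p0 /= e_irr.
Qed.

(* [b] is the third vertex on a shortest path from the closest center [a]. *)
Lemma edge_covered (A : {set V}) a u v : a \in A -> e u v ->
  (forall x, x \in A -> d a u <= d x u)%N ->
  (forall x, x \in A -> d a u <= d x v)%N ->
  u \in near d A \/ [/\ (u, v) \in candidates d A & (v, u) \in candidates d A].
Proof.
move=> aA uv au av; have [p [ap lp sp]] := graph_dist_path a u.
have [le2|gt2] := leqP (d a u) 2.
  by left; rewrite inE; apply/exists_inP; exists a.
right; case: p ap lp sp => [|x [|b p]] /=; try by move=> _ _ h; rewrite -h in gt2.
case/and3P=> ax xb bp lp sp.
have bS : b \in near d A.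
  rewrite inE; apply/exists_inP; exists a => //.
  by have := @graph_dist_le a [:: x; b]; rewrite /= ax xb; apply.
(* Being two steps ahead of [a] leaves one step for the edge to [v] and one for strictness. *)
have bu : ((d b u).+1 < d a u)%N by rewrite -sp !ltnS -lp graph_dist_le.
have bv : (d b v < d a u)%N.
  by apply: leq_trans bu; rewrite ltnS graph_dist_edge_le.
have [uC vC] : u \in cluster d A b /\ v \in cluster d A b.
  rewrite !inE; split; apply/forall_inP => y yA.
    by apply: leq_trans (au y yA); apply: ltnW.
  by apply: leq_trans (av y yA).
by rewrite !inE; split; apply/exists_inP; exists b; rewrite //= uC vC.
Qed.

Lemma card_near_leq (A : {set V}) (Delta : nat) : (max_degree e <= Delta)%N ->
  (#|near d A| <= #|A| * (1 + Delta + Delta ^ 2))%N.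
Proof.
move=> degD; pose N u : {set V} := [set v | e u v].
have cN u : (#|N u| <= Delta)%N.
  apply: leq_trans degD; rewrite cardsE; exact: (leq_bigmax u).
apply: (@leq_trans #|\bigcup_(a in A) ([set a] :|: N a :|: \bigcup_(u in N a) N u)|).
  apply/subset_leq_card/subsetP => b; rewrite inE => /exists_inP[a aA].
  have [p [ap lp <-]] := graph_dist_path a b.
  move=> p2; apply/bigcupP; exists a => //; rewrite !inE.
  case: p p2 ap lp => [_ _ /= ->|x [_ /andP[ax _] /= <-|y [|//] _]].
  - by rewrite eqxx.
  - by rewrite ax orbT.
  - move=> /and3P[ax xy _] /= <-; apply/orP; right.
    by apply/bigcupP; exists x; rewrite inE.
apply: card_cover_leq => a _.
apply: leq_trans (leq_card_setU _ _) _; apply: leq_add.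
  by rewrite (leq_trans (leq_card_setU _ _)) // cards1 leq_add2l.
rewrite expnS expn1; apply: leq_trans (card_cover_leq (fun u _ => cN u)) _.
by rewrite leq_mul2r cN orbT.
Qed.

Lemma graph_metric_ext (e' : rel V) : e' =2 e -> graph_metric e' = graph_metric e.
Proof.
move=> ee'; apply/ffunP => -[u v]; rewrite !ffunE; apply: eq_find => k.
by apply: eq_existsb => p; rewrite (eq_path ee').
Qed.

Lemma returns_reconstruct (A : {set V}) : ((0 < #|V|)%N -> A != set0) ->
  returns d (reconstruct A) (graph_metric e).
Proof.
move=> A0; do 2![apply: returns_ask]; rewrite near_known.
rewrite -!/(known_rows _ _ _) candidates_known //; apply: returns_ask => /=.
set K := known _ _ _; have [e_sym _] := e_simple.
apply: graph_metric_ext => u v /=.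
(* Every entry is a true distance or the default 0, so the value 1 certifies an edge. *)
have Ke x y : K (x, y) == 1%N -> e x y.
  rewrite ffunE !known_rowsE ffunE -graph_dist_eq1 /=.
  by do 3![case: ifP => //].
apply/orP/idP => [[/Ke //|/Ke]|uv]; first by rewrite e_sym.
have Kcand x y : e x y -> (x, y) \in candidates d A -> K (x, y) == 1%N.
  by rewrite -graph_dist_eq1 ffunE mem_enum => ? ->.
have Knear x y : e x y -> x \in near d A -> K (x, y) == 1%N.
  by rewrite -graph_dist_eq1 ffunE known_rowsE => /= ? ->; case: ifP.
have /A0/set0Pn[a0 a0A] : (0 < #|V|)%N by apply/card_gt0P; exists u.
pose closest x := [arg min_(a < a0 in A) d a x].
have closestP x : closest x \in A /\ forall a, a \in A -> (d (closest x) x <= d a x)%N.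
  by rewrite /closest; case: arg_minnP.
have [uA umin] := closestP u; have [vA vmin] := closestP v.
have vu : e v u by rewrite e_sym.
(* Start from the end closer to [A]: its distance to [A] then bounds from below that of both ends,
   as [edge_covered] requires. *)
have [le_uv|le_vu] := leqP (d (closest u) u) (d (closest v) v).
  have [|/(Knear _ _ uv)|[/(Kcand _ _ uv)]] := edge_covered uA uv umin; try by left.
  by move=> a aA; apply: leq_trans le_uv (vmin a aA).
have [|/(Knear _ _ vu)|[/(Kcand _ _ vu)]] := edge_covered vA vu vmin; try by right.
by move=> a aA; apply: leq_trans (ltnW le_vu) (umin a aA).
Qed.

(** Forces [Delta >= 1], so that [Delta ^ 2] absorbs lower powers. *)
Lemma max_degree_gt0 : (1 < #|V|)%N -> (0 < max_degree e)%N.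
Proof.
case/card_gt1P => u [v [_ _ uv]]; have [p [up lp _]] := graph_dist_path u v.
case: p up lp => [_ /= uv0|x p /= /andP[ux _] _]; first by rewrite uv0 eqxx in uv.
apply: leq_trans (leq_bigmax u).
by apply/card_gt0P; exists x.
Qed.

End ShortestPaths.

(** * Choice of parameters and the explicit query bound *)

Definition sqrt_ceil n := (PeanoNat.Nat.sqrt n).+1.

(* Twice a base-2 logarithm, so that 2 ^ log_rounds n >= n ^ 2. *)
Definition log_rounds n := (2 * (trunc_log 2 n).+1)%N.

(** Drawing twice as many centers as test points halves [W] on average. The starting set is a single
    vertex, so that the set of centers is nonempty whenever [V] is. *)
Definition reconstruction_alg (V : finType) : query_alg V {ffun V * V -> nat} :=
  let r := sqrt_ceil #|V| in
  let l := log_rounds #|V| in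
  refine_centers (2 * (r * l)) (r * l) l [set x in take 1 (enum V)] [set: V]
    (@reconstruct V).

Lemma leq_sqr_sqrt_ceil n : (n <= sqrt_ceil n * sqrt_ceil n)%N.
Proof. have := PeanoNat.Nat.sqrt_spec n; rewrite /sqrt_ceil; lia. Qed.

Lemma sqrt_ceil_sqr_leq n : (0 < n)%N -> (sqrt_ceil n ^ 2 <= 4 * n)%N.
Proof.
move=> n0; rewrite expnS expn1 /sqrt_ceil.
by have := PeanoNat.Nat.sqrt_spec n; case: (PeanoNat.Nat.sqrt n) => [|s]; nia.
Qed.

Lemma sqr_leq_log_rounds n : (n ^ 2 <= 2 ^ log_rounds n)%N.
Proof. by rewrite /log_rounds mulnC expnM leq_exp2r // ltnW // trunc_log_ltn. Qed.

Lemma returns_reconstruction_alg (V : finType) (e : rel V) :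
  simple_graph e -> connected_graph e ->
  returns (graph_dist e) (reconstruction_alg V) (graph_metric e).
Proof.
move=> e_simple e_conn; apply: returns_refine => A sA.
apply: returns_reconstruct => // V0; apply: contraTneq sA => ->.
rewrite subset0 -card_gt0; rewrite cardE in V0.
case: (enum V) V0 => //= x s _.
by apply/card_gt0P; exists x; rewrite !inE eqxx.
Qed.

Lemma expected_queries_reconstruction_alg (R : realType) (V : finType) (e : rel V)
    (Delta : nat) (r := sqrt_ceil #|V|) (l := log_rounds #|V|) :
  simple_graph e -> connected_graph e -> (1 < #|V|)%N ->
  (max_degree e <= Delta)%N ->
  expected_queries R (graph_dist e) (reconstruction_alg V) <=
    (51 * (Delta ^ 2 * (r * l ^ 2 * #|V|)))%:R.
Proof.
move=> e_simple e_conn V1 degD; have V0 := ltnW V1.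
have D0 : (0 < Delta)%N by apply: leq_trans degD; apply: max_degree_gt0.
have r0 : (0 < r)%N by [].
have l0 : (0 < l)%N by rewrite /l /log_rounds muln_gt0.
(* [a] bounds the number of centers, at most [1 + 2 r l^2]; [c] bounds the size of [near], using
   [1 + Delta + Delta^2 <= 3 Delta^2]. *)
pose a := (3 * (r * l ^ 2))%N.
pose c := (3 * (a * Delta ^ 2))%N.
have bound (A : {set V}) : (#|A| <= #|[set x in take 1 (enum V)]| + l * (2 * (r * l)))%N ->
    expected_queries R (graph_dist e) (reconstruct A) <=
    (a * #|V| + c * #|V| + c * r ^ 2)%:R +
    #|V|%:R ^+ 2 * #|large (graph_dist e) r A|%:R.
  move=> cA; have {}cA : (#|A| <= a)%N.
    apply: leq_trans cA _; apply: (@leq_trans (1 + l * (2 * (r * l)))).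
      rewrite leq_add2r cardsE (leq_trans (card_size _)) // size_take.
      by case: ifP => // /negbT; rewrite -leqNgt.
    have : (0 < r * l ^ 2)%N by rewrite muln_gt0 expn_gt0 r0 l0.
    by rewrite /a !expnS expn0; nia.
  have nc : (#|near (graph_dist e) A| <= c)%N.
    apply: leq_trans (card_near_leq e_conn A degD) _.
    apply: (@leq_trans (a * (3 * Delta ^ 2))); last by rewrite /c mulnCA.
    apply: leq_mul => //; nia.
  apply: le_trans (expected_queries_reconstruct R r nc) _.
  by rewrite lerD2r ler_nat !leq_add2r leq_mul2r cA orbT.
have rl0 : (0 < 2 * (r * l))%N by rewrite muln_gt0 muln_gt0 r0 l0.
apply: le_trans (expected_queries_refine _ V0 r0 (leq_sqr_sqrt_ceil _) rl0 (leqnSn _)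
  (exprn_ge0 2 (ler0n R #|V|)) bound) _.
rewrite setDT cards0 cardsT addr0.
(* The choice of [l] cancels the cost [#|V| ^ 2] of a large cluster, leaving [#|V| (1 + l)] for all
   of them. *)
have V2l : #|V|%:R ^+ 2 / 2 ^+ l <= 1 :> R.
  by rewrite ler_pdivrMr ?exprn_gt0 // mul1r -!natrX ler_nat sqr_leq_log_rounds.
have -> : #|V|%:R ^+ 2 * (#|V|%:R / 2 ^+ l + l%:R * (#|V|%:R / 2 ^+ l)) =
   #|V|%:R ^+ 2 / 2 ^+ l * (#|V|%:R * (1 + l%:R)) :> R by ring.
apply: le_trans (lerD (lexx _) (ler_wpM2r _ V2l)) _.
  by rewrite mulr_ge0 // addr_ge0.
rewrite mul1r nat1r -natrM -!natrD ler_nat.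
have r2 : (r ^ 2 <= 4 * #|V|)%N by exact: sqrt_ceil_sqr_leq.
have D2 : (0 < Delta ^ 2)%N by rewrite expn_gt0 D0.
set X := (r * l ^ 2)%N in a c bound *.
have lX : (l.+1 <= 2 * X)%N.
  by rewrite /X !expnS expn0; nia.
have -> : (l * (#|V| * (r * l)) = X * #|V|)%N by rewrite /X !expnS expn0; lia.
have h1 : (c * r ^ 2 <= c * (4 * #|V|))%N by rewrite leq_mul2l r2 orbT.
have h2 : (#|V| * l.+1 <= #|V| * (2 * X))%N by rewrite leq_mul2l lX orbT.
have h3 : (X * #|V| <= Delta ^ 2 * (X * #|V|))%N by rewrite leq_pmull.
(* In units of [Delta^2 X #|V|]: 1 for the test sets, 3 for the rows of [A], 9 for those of [near],
   36 for pairs in clusters, 2 for large clusters; together 51. *)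
move: h1 h2 h3; rewrite /c /a; nia.
Qed.

(** * Asymptotic estimates and the final bound *)

Section Asymptotics.
Variable R : realType.

Lemma log_rounds_le n : (1 < n)%N -> (log_rounds n)%:R <= 4 / ln 2 * ln n%:R :> R.
Proof.
move=> n1; set t := trunc_log 2 n.
have ln2 : 0 < ln 2 :> R by rewrite ln_gt0 // ltr1n.
have t0 : (0 < t)%N by rewrite /t trunc_log_gt0.
apply: (@le_trans _ _ (4 * t%:R)).
  by rewrite -natrM ler_nat /log_rounds -/t; lia.
rewrite -mulrA ler_pM2l // mulrC ler_pdivlMr // mulrC mulr_natr -lnXn //.
rewrite ler_ln ?posrE ?exprn_gt0 ?ltr0n ?(ltnW n1) //.
by rewrite -natrX ler_nat trunc_logP // ltnW.
Qed.

Lemma sqrt_ceil_le n : (0 < n)%N ->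
  (sqrt_ceil n * n)%:R <= 2 * n%:R `^ (3 / 2) :> R.
Proof.
move=> n0; have -> : 3 / 2 = 1 + 2^-1 :> R by field.
rewrite powRD; last by apply/implyP => _; rewrite pnatr_eq0 -lt0n.
rewrite powRr1 // powR12_sqrt // natrM mulrCA mulrC ler_pM2l ?ltr0n //.
rewrite -(@ler_pXn2r _ 2) // ?nnegrE ?mulr_ge0 ?sqrtr_ge0 //.
rewrite exprMn sqr_sqrtr // -!natrX -natrM ler_nat.
exact: sqrt_ceil_sqr_leq.
Qed.

(** Supplies the threshold from which the double logarithm may be inserted as a factor. *)
Lemma lnln_ge1 n : (Num.trunc (expR (expR 1 : R)) < n)%N -> 1 <= ln (ln n%:R) :> R.
Proof.
move=> tn; have en : expR (expR 1) <= n%:R :> R.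
  by apply: ltW; rewrite -truncn_lt_nat ?expR_ge0.
have h x (y : R) : expR x <= y -> x <= ln y.
  by move=> xy; rewrite -ler_expR lnK // posrE (lt_le_trans (expR_gt0 x)).
by apply/h/h.
Qed.

End Asymptotics.

Theorem theorem1 (R : realType) :
  exists A : forall V : finType, query_alg V {ffun V * V -> nat},
  exists (C : R) (n0 : nat), 0 < C /\
  forall (V : finType) (e : rel V) (n Delta : nat),
    simple_graph e -> connected_graph e ->
    #|V| = n -> (max_degree e <= Delta)%N ->
    prob_output R (graph_dist e) (A V) (graph_metric e) = 1 /\
    ((n0 <= n)%N ->
     expected_queries R (graph_dist e) (A V) <=
       C * (Delta%:R ^+ 4 * n%:R `^ (3 / 2) * ln n%:R ^+ 2 * ln (ln n%:R))).
Proof.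
exists reconstruction_alg.
(* 51 is from the query count, 2 from [sqrt_ceil_le], and [4 / ln 2] from each of the two factors
   [log_rounds]. *)
pose C : R := 51 * (2 * (4 / ln 2) ^+ 2).
have ln2 : 0 < ln 2 :> R by rewrite ln_gt0 // ltr1n.
have C0 : 0 < C by rewrite /C !mulr_gt0 ?invr_gt0.
exists C, (maxn 2 (Num.trunc (expR (expR 1 : R))).+1); split=> // V e n Delta.
move=> e_simple e_conn cV degD; split.
  exact/returns_prob/returns_reconstruction_alg.
rewrite geq_max -cV => /andP[V1 /lnln_ge1 lnln].
apply: le_trans (expected_queries_reconstruction_alg R e_simple e_conn V1 degD) _.
have V0 := ltnW V1.
have lnV : 0 <= ln #|V|%:R :> R by rewrite ln_ge0 // ler1n.
have P0 : 0 <= #|V|%:R `^ (3 / 2) * ln #|V|%:R ^+ 2 :> R.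
  by rewrite mulr_ge0 ?powR_ge0 ?exprn_ge0.
apply: (@le_trans _ _ (51 * (Delta%:R ^+ 2 *
    (2 * #|V|%:R `^ (3 / 2) * (4 / ln 2 * ln #|V|%:R) ^+ 2)))).
  rewrite natrM ler_wpM2l // natrM natrX ler_wpM2l ?exprn_ge0 //.
  rewrite mulnAC natrM natrX ler_pM ?exprn_ge0 ?sqrt_ceil_le //.
  by rewrite lerXn2r ?nnegrE ?log_rounds_le // mulr_ge0 // divr_ge0 // ltW.
have -> : 51 * (Delta%:R ^+ 2 *
    (2 * #|V|%:R `^ (3 / 2) * (4 / ln 2 * ln #|V|%:R) ^+ 2)) =
    C * (Delta%:R ^+ 2 * (#|V|%:R `^ (3 / 2) * ln #|V|%:R ^+ 2)) by rewrite /C; ring.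
(* It remains to compare [Delta^2] with [Delta^4] and 1 with [ln (ln n)]. *)
rewrite ler_pM2l // -[Delta%:R ^+ 4 * _ * _]mulrA -[leLHS]mulr1.
apply: ler_pM => //; first by rewrite mulr_ge0 ?exprn_ge0.
rewrite ler_wpM2r // -!natrX ler_nat.
case: Delta {degD} => // D; exact: leq_pexp2l.
Qed.
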